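(* Let $u$ be a quasi-definite moment functional on $\mathcal{P}=\mathbb{R}[x_1,\dots,x_d]$, and let $\{\mathbb{P}_n\}_{n\ge 0}$ be a weak orthogonal polynomial system (WOPS) with respect to $u$. For a symmetric $d\times d$ polynomial matrix $\Phi=(\phi_{ij})$ with $\deg\Phi=p\ge0$ and a $d\times1$ polynomial matrix $\Psi=(\psi_i)$ with $\deg\Psi=q\ge1$, put $s=\max\{p-2,q-1\}$ and $$L[f]=\operatorname{div}(\Phi\nabla f)+\tilde\Psi^t\nabla f=\sum_{i,j=1}^d\phi_{ij}\,\partial_{ij}^2 f+\sum_{i=1}^d\psi_i\,\partial_i f,\qquad \tilde\Psi=\Psi-(\operatorname{div}\Phi)^t .$$ Consider the following property of the pair $(\Phi,\Psi)$: there exist real matrices $\Lambda_i^n\in\mathcal{M}_{r_i\times r_n}(\mathbb{R})$ such that $$L[\mathbb{P}_n^t]=\sum_{i=n-s}^{n+s}\mathbb{P}_i^t\,\Lambda_i^n\quad\text{for } n\ge s+1,\qquad\text{and}\qquad L[\mathbb{P}_n^t]=\sum_{i=1}^{n+s}\mathbb{P}_i^t\,\Lambda_i^n\quad\text{for } 0\le n\le s \qquad (\ast)$$ (that is, the coefficient $\Lambda_0^n$ of $\mathbb{P}_0^t$ vanishes for all $n\ge0$). Then $u$ is semiclassical if and only if such a matrix differential-difference relation holds, in the following precise sense. (i) If $u$ is semiclassical, with $\Phi,\Psi$ as in the definition of semiclassical functional (so in addition $\det\langle u,\Phi\rangle\neq0$ and $\operatorname{div}(\Phi u)=\Psi^tu$),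 then $(\Phi,\Psi)$ satisfies $(\ast)$. (ii) Conversely, if there exist a symmetric $d\times d$ polynomial matrix $\Phi$ with $\deg\Phi=p\ge0$ and a $d\times1$ polynomial matrix $\Psi$ with $\deg\Psi=q\ge1$, with $\det\langle u,\Phi\rangle\ne0$ and such that the pair $(\Phi,\Psi)$ satisfies $(\ast)$ (where $s=\max\{p-2,q-1\}$ and $L[f]=\operatorname{div}(\Phi\nabla f)+\tilde\Psi^t\nabla f$ with $\tilde\Psi=\Psi-(\operatorname{div}\Phi)^t$), then $u$ is semiclassical.
   Context: Polynomials and functionals. $\mathcal{P}$ is the space of real polynomials in $d$ variables $x_1,\dots,x_d$, $\mathcal{P}_n$ the subspace of polynomials of total degree at most $n$, and $r_n=\binom{n+d-1}{n}$ is the dimension of the space of homogeneous polynomials of degree $n$. $\mathcal{M}_{h\times k}(\mathbb{R})$ denotes the real $h\times k$ matrices. A moment functional is a linear functional $u:\mathcal{P}\to\mathbb{R}$, $f\mapsto\langle u,f\rangle$; for a matrix $M$ of polynomials, $\langle u,M\rangle$ denotes the real matrix obtained by applying $u$ entrywise. The degree of a polynomial matrix is the maximum of the degrees of its entries. Polynomial systems. For each $n\ge0$, $\mathbb{P}_n$ is an $r_n\times1$ column vector whose entries are polynomials of total degree $n$; $\{\mathbb{P}_n\}_{n\ge0}$ is a polynomial system if, for each $n$, the entries of $\mathbb{P}_0,\dots,\mathbb{P}_n$ form a basis of $\mathcal{P}_n$. A polynomial system is a weak orthogonal polynomial system (WOPS) with respect to $u$ if $\langle u,\mathbb{P}_n\mathbb{P}_m^t\rangle=0$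 for $m\ne n$ and $\langle u,\mathbb{P}_n\mathbb{P}_n^t\rangle=H_n$ is a nonsingular $r_n\times r_n$ matrix for every $n$. The functional $u$ is quasi-definite if there exists a WOPS with respect to $u$. Operators. $\nabla f=(\partial_1 f,\dots,\partial_d f)^t$; for a $d\times k$ polynomial matrix $M$ with rows $M_1,\dots,M_d$, $\operatorname{div}M=\sum_{i=1}^d\partial_i M_i$ (a $1\times k$ row). $L[\mathbb{P}_n^t]$ is the $1\times r_n$ row obtained by applying $L$ to each entry of $\mathbb{P}_n^t$. Semiclassical functional. A quasi-definite moment functional $u$ is semiclassical if there exist a symmetric $d\times d$ polynomial matrix $\Phi$ with $\deg\Phi=p\ge0$ and a $d\times1$ polynomial matrix $\Psi$ with $\deg\Psi=q\ge1$ such that $\det\langle u,\Phi\rangle\ne0$ and the matrix Pearson-type equation $\operatorname{div}(\Phi u)=\Psi^t u$ holds, meaning $$\langle u,\ \Phi\,\nabla f+\Psi f\rangle=0\in\mathbb{R}^d\quad\text{for all } f\in\mathcal{P}.$$ One sets $s=\max\{p-2,q-1\}\ge0$. *)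

(* Defs.v *)
From HB Require Import structures.
From mathcomp Require Import all_boot all_order all_algebra.
From mathcomp Require Import mpoly reals.

Set Implicit Arguments.
Unset Strict Implicit.
Unset Printing Implicit Defensive.

Import Order.TTheory GRing.Theory Num.Theory.

Local Open Scope ring_scope.

(* The dimension of the homogeneous polynomials of degree n in d variables;
   the formula is only meaningful for 0 < d. *)
Definition rdim (d n : nat) : nat := 'C(n + d - 1, n).

Section Operators.
Variables (R : realType) (d : nat).
Implicit Types (f : {mpoly R[d]}).

Definition grad f : 'cV[{mpoly R[d]}]_d := \col_i f^`M(i).

Definition mxdiv (k : nat) (M : 'M[{mpoly R[d]}]_(d, k)) : 'rV[{mpoly R[d]}]_k :=
  \sum_(i < d) map_mx (mderiv i) (row i M).

(* msize is the total degree plus one (and 0 at the zero polynomial), so a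
   matrix with a degree in this sense is nonzero. *)
Definition has_deg (h k : nat) (M : 'M[{mpoly R[d]}]_(h, k)) (p : nat) : Prop :=
  (\max_(i < h) \max_(j < k) msize (M i j))%N = p.+1.

Definition Lop (Phi : 'M[{mpoly R[d]}]_d) (Psi : 'cV[{mpoly R[d]}]_d) f :
    {mpoly R[d]} :=
  let tPsi := Psi - (mxdiv Phi)^T in
  (mxdiv (Phi *m grad f) + tPsi^T *m grad f) 0 0.

Lemma LopE (Phi : 'M[{mpoly R[d]}]_d) (Psi : 'cV[{mpoly R[d]}]_d) f :
  Lop Phi Psi f =
    \sum_(i < d) \sum_(j < d) Phi i j * (f^`M(j))^`M(i)
    + \sum_(i < d) Psi i 0 * f^`M(i).
Proof.
have divE k (M : 'M[{mpoly R[d]}]_(d, k)) j :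
  mxdiv M 0 j = \sum_(i < d) (M i j)^`M(i).
  by rewrite summxE; apply: eq_bigr => i _; rewrite !mxE.
rewrite /Lop !mxE divE.
have -> : \sum_(i < d) ((Phi *m grad f) i 0)^`M(i) =
  \sum_(i < d) \sum_(j < d) Phi i j * (f^`M(j))^`M(i)
  + \sum_(j < d) mxdiv Phi 0 j * f^`M(j).
  under [X in _ + X]eq_bigr => j _ do rewrite divE mulr_suml.
  rewrite [X in _ + X]exchange_big -big_split; apply: eq_bigr => i _ /=.
  rewrite mxE raddf_sum -big_split; apply: eq_bigr => j _ /=.
  by rewrite mxE mderivM addrC.
rewrite -addrA -big_split; congr (_ + _); apply: eq_bigr => j _ /=.
by rewrite !mxE -mulrDl addrCA subrr addr0.
Qed.

End Operators.

Section Functionals.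
Variables (R : realType) (d : nat).

Definition poly_seq : Type := forall n : nat, 'cV[{mpoly R[d]}]_(rdim d n).

Definition lincomb (P : poly_seq) (n : nat)
    (c : forall k : nat, 'cV[R]_(rdim d k)) : {mpoly R[d]} :=
  \sum_(k < n.+1) \sum_(i < rdim d k) c k i 0 *: P k i 0.

Definition poly_system (P : poly_seq) : Prop :=
  forall n : nat,
    [/\ forall i, msize (P n i 0) = n.+1,
        forall c, lincomb P n c = 0 -> forall k, (k <= n)%N -> c k = 0
      & forall f : {mpoly R[d]}, (msize f <= n.+1)%N ->
          exists c, f = lincomb P n c].

Definition wops (u : {scalar {mpoly R[d]}}) (P : poly_seq) : Prop :=
  [/\ poly_system P,
      forall n m, m != n -> map_mx u (P n *m (P m)^T) = 0
    & forall n, map_mx u (P n *m (P n)^T) \in unitmx].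

Definition quasi_definite (u : {scalar {mpoly R[d]}}) : Prop :=
  exists P, wops u P.

Definition admissible (Phi : 'M[{mpoly R[d]}]_d) (Psi : 'cV[{mpoly R[d]}]_d)
    (p q : nat) : Prop :=
  [/\ Phi^T = Phi, has_deg Phi p, has_deg Psi q & (1 <= q)%N].

Definition pearson (u : {scalar {mpoly R[d]}})
    (Phi : 'M[{mpoly R[d]}]_d) (Psi : 'cV[{mpoly R[d]}]_d) : Prop :=
  forall f : {mpoly R[d]}, map_mx u (Phi *m grad f + f *: Psi) = 0.

Definition semiclassical_pair (u : {scalar {mpoly R[d]}})
    (Phi : 'M[{mpoly R[d]}]_d) (Psi : 'cV[{mpoly R[d]}]_d) (p q : nat) : Prop :=
  [/\ admissible Phi Psi p q, \det (map_mx u Phi) != 0 & pearson u Phi Psi].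

Definition semiclassical (u : {scalar {mpoly R[d]}}) : Prop :=
  quasi_definite u /\
  exists (Phi : 'M[{mpoly R[d]}]_d) (Psi : 'cV[{mpoly R[d]}]_d) (p q : nat),
    semiclassical_pair u Phi Psi p q.

(* Truncated subtraction is harmless: q >= 1 in every admissible pair, so the
   integer maximum is nonnegative. *)
Definition shift (p q : nat) : nat := maxn (p - 2) (q - 1).

Definition diff_rel (P : poly_seq) (Phi : 'M[{mpoly R[d]}]_d)
    (Psi : 'cV[{mpoly R[d]}]_d) (s : nat) : Prop :=
  exists Lam : forall n i : nat, 'M[R]_(rdim d i, rdim d n),
    (forall n, (s.+1 <= n)%N ->
       map_mx (Lop Phi Psi) (P n)^T =
         \sum_(n - s <= i < (n + s).+1)
            (P i)^T *m map_mx (@mpolyC d R) (Lam n i)) /\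
    (forall n, (n <= s)%N ->
       map_mx (Lop Phi Psi) (P n)^T =
         \sum_(1 <= i < (n + s).+1)
            (P i)^T *m map_mx (@mpolyC d R) (Lam n i)).

End Functionals.

(* Main.v *)
Require Import Defs.
From HB Require Import structures.
From mathcomp Require Import all_boot all_order all_algebra.
From mathcomp Require Import mpoly reals.
From mathcomp Require Import zify ring.

Set Implicit Arguments.
Unset Strict Implicit.
Unset Printing Implicit Defensive.

Import Order.TTheory GRing.Theory Num.Theory.

Local Open Scope ring_scope.

(** Write <u, f> for u f and Gamma f g = sum_ij phi_ij (d_i f) (d_j g).

The Pearson equation, read on g * d_i f and summed over i, is the Green
formula <u, g L f> = - <u, Gamma f g> ([pearson_Green]).  As Phi is symmetric,
L is then symmetric for u ([pearson_Lop_sym]).  Since L raises degrees by at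
most s ([msize_Lop]) and kills constants, <u, (L P_n) P_k^t> = <u, P_n L[P_k^t]>
vanishes for k + s < n and for k = 0.  These inner products determine the
coefficients of L P_n in the system, because the Gram matrices are invertible
([fourier_expansion_from]); this gives the differential-difference relation
([pearson_diff_rel]).

Conversely, the relation does not visibly return the Pearson equation for Psi
itself, but it provides some Psi' for which the Pearson equation holds with the
same Phi, which is enough.  The vanishing of the coefficients of P_0 says that
<u, L f> = 0 for all f ([diff_rel_mean0]), and the lower cut-off n - s of the
sum says that <u, x_k L P_n> = 0 for n > s + 1 ([diff_rel_lin_ortho]).  The
Leibniz rule
  L (x_k f) = x_k L f + psi_k f + 2 sum_j phi_kj d_j f
([LopM_X]) then shows that the functional f |-> <u, sum_j phi_kj d_j f>
vanishes on P_n for n large.  A functional with this property is of the form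
f |-> <u, a f> for a polynomial a ([wops_functional_repr]), and - a is the k-th
entry of Psi' ([diff_rel_pearson]).  Finally Psi' has degree at least 1: were it
constant, f = 1 would give Psi' = 0, and f = x_k would give <u, Phi> = 0,
against the invertibility of <u, Phi> ([pearson_nonconstant]). *)

(** * Degrees *)

Section Degrees.

(** Unlike [msizeM], this bound also holds when a factor is zero. *)
Lemma msizeM_leq (R : idomainType) (d : nat) (f g : {mpoly R[d]}) :
  (msize (f * g) <= (msize f + msize g).-1)%N.
Proof.
have [->|f0] := eqVneq f 0; first by rewrite mul0r msize0.
have [->|g0] := eqVneq g 0; first by rewrite mulr0 msize0.
by rewrite msizeM.
Qed.

Lemma msize_mderiv (R : nzRingType) (d : nat) (i : 'I_d) (f : {mpoly R[d]}) :
  (msize f^`M(i) <= (msize f).-1)%N.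
Proof.
rewrite [leqLHS]msizeE; apply/bigmax_leqP_seq => m + _.
rewrite mcoeff_msupp mcoeff_mderiv => nz.
have : (m + U_(i))%MM \in msupp f.
  by rewrite mcoeff_msupp; apply: contraNneq nz => ->; rewrite mul0rn.
by move/msize_mdeg_lt; rewrite mdegD mdeg1; lia.
Qed.

Lemma msize_sum_leq (R : nzRingType) (d : nat) (I : Type) (r : seq I)
    (Q : pred I) (F : I -> {mpoly R[d]}) (b : nat) :
  (forall i, Q i -> (msize (F i) <= b)%N) ->
  (msize (\sum_(i <- r | Q i) F i) <= b)%N.
Proof.
move=> Fb; apply: leq_trans (mmeasure_sum _ _ _ _) _.
by elim/big_ind: _ => // x y xb yb; rewrite geq_max xb.
Qed.

Variables (R : realType) (d : nat).
Implicit Types (f : {mpoly R[d]}).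

Lemma msize_entry_leq (h k : nat) (M : 'M[{mpoly R[d]}]_(h, k)) i j :
  (msize (M i j) <= \max_(i < h) \max_(j < k) msize (M i j))%N.
Proof.
apply: leq_trans (leq_bigmax (F := fun i => \max_j msize (M i j)) i).
exact: (leq_bigmax (F := fun j => msize (M i j)) j).
Qed.

Lemma has_deg_msize (h k : nat) (M : 'M[{mpoly R[d]}]_(h, k)) (p : nat) :
  has_deg M p -> forall i j, (msize (M i j) <= p.+1)%N.
Proof. by move=> <- i j; apply: msize_entry_leq. Qed.

(** The operator raises the degree by at most [shift p q]. *)
Lemma msize_Lop (Phi : 'M[{mpoly R[d]}]_d) (Psi : 'cV[{mpoly R[d]}]_d)
    (p q n : nat) f :
  has_deg Phi p -> has_deg Psi q -> (1 <= q)%N -> (msize f <= n.+1)%N ->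
  (msize (Lop Phi Psi f) <= (n + shift p q).+1)%N.
Proof.
move=> /has_deg_msize hPhi /has_deg_msize hPsi q1 hf; rewrite LopE.
(* Restated over the ring structure of the entries, so that all sizes below are
   syntactically the same arithmetic atoms. *)
have leM (g h : {mpoly R[d]}) : (msize (g * h) <= (msize g + msize h).-1)%N :=
  msizeM_leq g h.
have s1 : (p <= shift p q + 2)%N by rewrite /shift; lia.
have s2 : (q <= shift p q + 1)%N by rewrite /shift; lia.
apply: leq_trans (mmeasureD_le _ _ _) _; rewrite geq_max; apply/andP; split.
  apply: msize_sum_leq => i _; apply: msize_sum_leq => j _.
  (* A nonzero second derivative forces deg f >= 2, so that the truncated
     degrees below are exact. *)
  have := msize_mderiv i (f^`M(j)); have := msize_mderiv j f.
  have := leM (Phi i j) (f^`M(j))^`M(i); have := hPhi i j.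
  have [->|] := eqVneq (f^`M(j))^`M(i) 0; first by rewrite mulr0 msize0.
  by rewrite -(msize_poly_eq0 (f^`M(j))^`M(i)); lia.
apply: msize_sum_leq => i _.
have := msize_mderiv i f; have := hPsi i 0.
have := leM (Psi i 0) f^`M(i).
have [->|] := eqVneq f^`M(i) 0; first by rewrite mulr0 msize0.
by rewrite -(msize_poly_eq0 f^`M(i)); lia.
Qed.

End Degrees.

(** * The differential operator *)

Lemma mderivXU (R : nzRingType) (d : nat) (i k : 'I_d) :
  ('X_k : {mpoly R[d]})^`M(i) = (i == k)%:R.
Proof.
rewrite mderivX mnm1E eq_sym; case: eqP => [->|_]; last by rewrite scale0r.
rewrite scale1r (_ : (U_(k) - U_(k))%MM = 0%MM) ?mpolyX0 //.
by apply/mnmP=> j; rewrite !mnmE subnn.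
Qed.

Section Operator.
Variables (R : realType) (d : nat).
Variables (Phi : 'M[{mpoly R[d]}]_d) (Psi : 'cV[{mpoly R[d]}]_d).
Implicit Types (f g : {mpoly R[d]}).

Lemma Lop_is_linear : linear (Lop Phi Psi).
Proof.
move=> c f g; rewrite !LopE scalerDr addrACA.
congr (_ + _); rewrite scaler_sumr -big_split; apply: eq_bigr => i _ /=.
  rewrite scaler_sumr -big_split; apply: eq_bigr => j _ /=.
  by rewrite !linearP mulrDr scalerAr.
by rewrite linearP mulrDr scalerAr.
Qed.

HB.instance Definition _ :=
  GRing.isLinear.Build R {mpoly R[d]} {mpoly R[d]} _ (Lop Phi Psi)
    Lop_is_linear.

Lemma LopC (c : R) : Lop Phi Psi c%:MP = 0.
Proof.
rewrite LopE !big1 ?addr0 // => i _; first by rewrite mderivC mulr0.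
by rewrite big1 // => j _; rewrite mderivC mderiv0 mulr0.
Qed.

(** The Leibniz rule for the second-order operator, against a coordinate. *)
Lemma LopM_X (k : 'I_d) f : Phi^T = Phi ->
  Lop Phi Psi ('X_k * f) =
    'X_k * Lop Phi Psi f + Psi k 0 * f + (\sum_j Phi k j * f^`M(j)) *+ 2.
Proof.
move=> symPhi.
have sy i j : Phi i j = Phi j i by rewrite -{1}symPhi mxE.
have delta (F : 'I_d -> {mpoly R[d]}) : \sum_i (i == k)%:R * F i = F k.
  rewrite (bigD1 k) //= eqxx mul1r big1 ?addr0 // => i /negbTE->.
  by rewrite mul0r.
rewrite !LopE.
have -> : \sum_i Psi i 0 * ('X_k * f)^`M(i) =
    'X_k * (\sum_i Psi i 0 * f^`M(i)) + Psi k 0 * f.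
  rewrite -[Psi k 0 * f](delta (fun i => Psi i 0 * f)) mulr_sumr -big_split.
  by apply: eq_bigr => i _ /=; rewrite mderivM mderivXU; ring.
have -> : \sum_i \sum_j Phi i j * ('X_k * f)^`M(j)^`M(i) =
    'X_k * (\sum_i \sum_j Phi i j * f^`M(j)^`M(i)) +
    (\sum_j Phi k j * f^`M(j)) *+ 2.
  (* The factor 2 collects the terms where d_j, respectively d_i, falls on
     'X_k; they agree by symmetry of Phi. *)
  have E1 : \sum_j Phi k j * f^`M(j) =
      \sum_i \sum_j (i == k)%:R * (Phi i j * f^`M(j)).
    by rewrite -(delta (fun i => \sum_j Phi i j * f^`M(j)));
       apply: eq_bigr => i _; rewrite mulr_sumr.
  have E2 : \sum_j Phi k j * f^`M(j) =
      \sum_i \sum_j (j == k)%:R * (Phi i j * f^`M(i)).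
    by rewrite E1 exchange_big; apply: eq_bigr => i _; apply: eq_bigr => j _;
       rewrite sy.
  rewrite mulr2n {1}E1 E2 mulr_sumr -!big_split; apply: eq_bigr => i _ /=.
  rewrite mulr_sumr -!big_split; apply: eq_bigr => j _ /=.
  rewrite mderivM mderivD !mderivM !mderivXU.
  have -> : ((j == k)%:R : {mpoly R[d]})^`M(i) = 0.
    by rewrite -mpolyC_nat mderivC.
  ring.
ring.
Qed.

End Operator.

(** * The Pearson equation *)

Section Pearson.
Variables (R : realType) (d : nat) (u : {scalar {mpoly R[d]}}).
Variables (Phi : 'M[{mpoly R[d]}]_d) (Psi : 'cV[{mpoly R[d]}]_d).
Implicit Types (f g : {mpoly R[d]}).

Lemma pearsonP : pearson u Phi Psi <->
  forall f i, u (\sum_j Phi i j * f^`M(j)) = - u (Psi i 0 * f).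
Proof.
have E f i : map_mx u (Phi *m grad f + f *: Psi) i 0 =
    u (\sum_j Phi i j * f^`M(j)) + u (Psi i 0 * f).
  rewrite !mxE raddfD mulrC; congr (u _ + _).
  by apply: eq_bigr => j _; rewrite mxE.
split=> [pea f i|h f].
  by apply/eqP; rewrite -addr_eq0 -E pea mxE.
by apply/colP=> i; rewrite E h addNr mxE.
Qed.

(** Integration by parts: the right-hand side is the bilinear form attached to
    Phi. *)
Lemma pearson_Green f g : pearson u Phi Psi ->
  u (g * Lop Phi Psi f) =
    - \sum_i \sum_j u (Phi i j * (g^`M(j) * f^`M(i))).
Proof.
move=> /pearsonP pea.
have -> : g * Lop Phi Psi f =
   \sum_i (\sum_j Phi i j * (g * f^`M(i))^`M(j) + Psi i 0 * (g * f^`M(i)))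
   - \sum_i \sum_j Phi i j * (g^`M(j) * f^`M(i)).
  rewrite LopE mulrDr big_split /= addrAC mulr_sumr -sumrB; congr (_ + _).
    apply: eq_bigr => i _; rewrite mulr_sumr -sumrB; apply: eq_bigr => j _.
    by rewrite mderivM (mderiv_comm i j); ring.
  by rewrite mulr_sumr; apply: eq_bigr => i _; ring.
rewrite raddfB /= raddf_sum big1 => [|i _]; last by rewrite raddfD /= pea addNr.
rewrite sub0r raddf_sum; congr -%R.
by apply: eq_bigr => i _; rewrite raddf_sum.
Qed.

Lemma pearson_Lop_sym f g : Phi^T = Phi -> pearson u Phi Psi ->
  u (g * Lop Phi Psi f) = u (f * Lop Phi Psi g).
Proof.
move=> symPhi pea; apply: etrans (pearson_Green f g pea) _.
apply: etrans _ (esym (pearson_Green g f pea)).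
congr -%R; rewrite exchange_big /=.
apply: eq_bigr => i _; apply: eq_bigr => j _.
by rewrite -{1}symPhi mxE; congr (u _); ring.
Qed.

End Pearson.

(** * Expansions in a weak orthogonal system *)

Section Fourier.
Variables (R : realType) (d : nat) (u : {scalar {mpoly R[d]}}).
Variables (P : poly_seq R d) (uP : wops u P).
Implicit Types (f g : {mpoly R[d]}).

(** The matrix H_n = <u, P_n P_n^t>. *)
Definition gram n : 'M[R]_(rdim d n) := map_mx u (P n *m (P n)^T).

(** The coefficients of f on P_n: the column H_n^-1 <u, f P_n>. *)
Definition fourier f n : 'cV[R]_(rdim d n) :=
  invmx (gram n) *m \col_i u (f * P n i 0).

Lemma gramE n i j : gram n i j = u (P n i 0 * P n j 0).
Proof. by rewrite !mxE big_ord1 mxE. Qed.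

Lemma wops_ortho m n i j : m != n -> u (P n i 0 * P m j 0) = 0.
Proof.
case: uP => _ + _ mn => /(_ n m mn) /matrixP /(_ i j).
by rewrite !mxE big_ord1 mxE.
Qed.

Lemma gram_unit n : gram n \in unitmx.
Proof. by case: uP => _ _; apply. Qed.

Lemma fourier_inner f n c m : f = lincomb P n c -> (m <= n)%N ->
  \col_i u (f * P m i 0) = gram m *m c m.
Proof.
move=> -> mn; apply/colP=> i.
have mn' : (m < n.+1)%N by [].
rewrite !mxE /lincomb mulr_suml raddf_sum (bigD1 (Ordinal mn')) //=.
rewrite [X in _ + X]big1 ?addr0 => [|k km].
  rewrite mulr_suml raddf_sum; apply: eq_bigr => j _ /=.
  by rewrite -scalerAl linearZ gramE /= mulrC [P m i 0 * _]mulrC.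
rewrite mulr_suml raddf_sum big1 // => j _ /=.
rewrite -scalerAl linearZ /= wops_ortho ?mulr0 // eq_sym.
by apply: contraNneq km => km; apply/eqP/val_inj.
Qed.

Lemma fourier_expansion f n : (msize f <= n.+1)%N ->
  f = lincomb P n (fourier f).
Proof.
case: uP => + _ _ => /(_ n) [_ _ span] /span [c fc].
rewrite {1}fc; apply: eq_bigr => k _; apply: eq_bigr => i _.
have kn : (k <= n)%N by rewrite -ltnS.
by rewrite /fourier (fourier_inner fc kn) mulKmx ?gram_unit.
Qed.

Lemma wops_orthogonal f n i : (msize f <= n)%N -> u (f * P n i 0) = 0.
Proof.
case: n i => [|n] i.
  by rewrite leqn0 msize_poly_eq0 => /eqP->; rewrite mul0r raddf0.
move/fourier_expansion=> ->; rewrite mulr_suml raddf_sum big1 // => k _ /=.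
rewrite mulr_suml raddf_sum big1 // => j _ /=.
rewrite -scalerAl linearZ /= wops_ortho ?mulr0 //.
by rewrite gtn_eqF.
Qed.

Lemma wops_functional_eq (v w : {scalar {mpoly R[d]}}) :
  (forall n i, v (P n i 0) = w (P n i 0)) -> forall f, v f = w f.
Proof.
move=> vw f; rewrite (@fourier_expansion f (msize f)) ?leqnSn //.
rewrite !raddf_sum; apply: eq_bigr => k _ /=.
by rewrite !raddf_sum; apply: eq_bigr => i _ /=; rewrite !linearZ /= vw.
Qed.

(** A functional that vanishes on all P_n of large degree is u multiplied by a
    polynomial: by duality with the Gram matrices it is enough to match the
    finitely many remaining values. *)
Lemma wops_functional_repr (v : {scalar {mpoly R[d]}}) (N : nat) :
  (forall n i, (N <= n)%N -> v (P n i 0) = 0) ->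
  exists a, forall f, v f = u (a * f).
Proof.
move=> v0.
pose c k : 'cV[R]_(rdim d k) := invmx (gram k) *m \col_i v (P k i 0).
pose a := lincomb P N c; exists a => f.
have lin : scalar (fun g => u (a * g)).
  by move=> b g h /=; rewrite mulrDr -scalerAr linearP.
pose w : {scalar {mpoly R[d]}} := HB.pack (fun g => u (a * g))
  (GRing.isLinear.Build R {mpoly R[d]} R _ (fun g => u (a * g)) lin).
apply: (wops_functional_eq (w := w)) => n i /=.
have [nN|Nn] := leqP n N.
  have /colP/(_ i) := fourier_inner (erefl a) nN.
  by rewrite mulKVmx ?gram_unit // !mxE.
rewrite v0 1?ltnW // wops_orthogonal //.
apply: msize_sum_leq => k _; apply: msize_sum_leq => j _.
apply: leq_trans (msizeZ_le _ _) _.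
case: uP => /(_ k) [-> _ _] _ _.
exact: leq_trans (ltn_ord k) Nn.
Qed.

Lemma msize_wops n i : msize (P n i 0) = n.+1.
Proof. by case: uP => /(_ n) []. Qed.

Lemma wops_mean0 n i : (0 < n)%N -> u (P n i 0) = 0.
Proof.
by move=> n0; rewrite -[P n i 0]mul1r wops_orthogonal // msize1.
Qed.

Lemma wops_mass_neq0 : u 1 != 0.
Proof.
apply/eqP => u1.
have r0 : (0 < rdim d 0)%N by rewrite /rdim bin0.
have gr0 : gram 0 = 0.
  apply/matrixP=> i j; rewrite gramE mxE.
  rewrite [P 0 i 0]msize1_polyC ?msize_wops //.
  rewrite [P 0 j 0]msize1_polyC ?msize_wops //.
  by rewrite -mpolyCM -[_%:MP]mulr1 mul_mpolyC linearZ /= u1 mulr0.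
have /mulVmx := gram_unit 0; rewrite gr0 mulmx0.
move/matrixP/(_ (Ordinal r0) (Ordinal r0)); rewrite !mxE eqxx.
by apply/eqP; rewrite eq_sym oner_eq0.
Qed.

Lemma fourier_eq0 f n : (forall i, u (f * P n i 0) = 0) -> fourier f n = 0.
Proof.
move=> f0; rewrite /fourier (_ : \col_i _ = 0) ?mulmx0 //.
by apply/colP=> i; rewrite !mxE.
Qed.

(** The expansion starts at rank m when f is orthogonal to all P_k, k < m. *)
Lemma fourier_expansion_from m N f : (m <= N.+1)%N -> (msize f <= N.+1)%N ->
  (forall k i, (k < m)%N -> u (f * P k i 0) = 0) ->
  f = \sum_(m <= k < N.+1) \sum_i fourier f k i 0 *: P k i 0.
Proof.
move=> mN fN f0; rewrite {1}(fourier_expansion fN) /lincomb.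
rewrite -(big_mkord xpredT (fun k => \sum_i fourier f k i 0 *: P k i 0)).
rewrite (big_cat_nat (n := m)) //= big_nat big1 ?add0r // => k /= km.
by rewrite big1 // => i _; rewrite fourier_eq0 ?mxE ?scale0r // => j; apply: f0.
Qed.

End Fourier.

(** * The differential-difference relation *)

Section Relation.
Variables (R : realType) (d : nat) (u : {scalar {mpoly R[d]}}).
Variables (P : poly_seq R d) (uP : wops u P).
Variables (Phi : 'M[{mpoly R[d]}]_d) (Psi : 'cV[{mpoly R[d]}]_d) (p q : nat).
Hypothesis adm : admissible Phi Psi p q.
Local Notation s := (shift p q).
Local Notation L := (Lop Phi Psi).

Lemma relation_entry n m N (Lam : forall i, 'M[R]_(rdim d i, rdim d n)) :
  map_mx L (P n)^T =
    \sum_(m <= i < N) (P i)^T *m map_mx (@mpolyC d R) (Lam i) <->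
  forall j, L (P n j 0) =
    \sum_(m <= i < N) \sum_a Lam i a j *: P i a 0.
Proof.
have E j : (\sum_(m <= i < N) (P i)^T *m map_mx (@mpolyC d R) (Lam i)) 0 j =
    \sum_(m <= i < N) \sum_a Lam i a j *: P i a 0.
  rewrite summxE; apply: eq_bigr => i _; rewrite mxE; apply: eq_bigr => a _.
  by rewrite !mxE mulrC mul_mpolyC.
split=> [/rowP h j|h]; first by rewrite -E -h !mxE.
by apply/rowP=> j; rewrite E -h !mxE.
Qed.

Lemma pearson_diff_rel : pearson u Phi Psi -> diff_rel P Phi Psi s.
Proof.
case: adm => symPhi dPhi dPsi q1 pea.
have sL n j : (msize (L (P n j 0%R)) <= (n + s).+1)%N.
  by apply: msize_Lop => //; rewrite (msize_wops uP).
have low n j k i : (k + s < n)%N -> u (L (P n j 0) * P k i 0) = 0.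
  move=> kn; rewrite mulrC pearson_Lop_sym // mulrC wops_orthogonal //.
  exact: leq_trans (sL k i) kn.
have mean n j i : u (L (P n j 0) * P 0 i 0) = 0.
  rewrite mulrC pearson_Lop_sym // [P 0 i 0]msize1_polyC ?(msize_wops uP) //.
  by rewrite LopC mulr0 raddf0.
pose Lam n i : 'M[R]_(rdim d i, rdim d n) :=
  \matrix_(a, j) fourier u P (L (P n j 0)) i a 0.
exists Lam; split=> n ns; apply/relation_entry => j;
  under [RHS]eq_bigr => i _ do under eq_bigr => a _ do rewrite mxE;
  apply: fourier_expansion_from => //; first by lia.
- by move=> k i kn; apply: low; lia.
- by move=> k i; rewrite ltnS leqn0 => /eqP k0; rewrite k0 in i *; exact: mean.
Qed.

Lemma diff_rel_mean0 : diff_rel P Phi Psi s -> forall f, u (L f) = 0.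
Proof.
move=> [Lam [hi lo]] f.
have lin : scalar (fun g => u (L g)) by move=> b g h /=; rewrite !linearP.
pose v : {scalar {mpoly R[d]}} := HB.pack (fun g => u (L g))
  (GRing.isLinear.Build R {mpoly R[d]} R _ (fun g => u (L g)) lin).
rewrite -[LHS]/(v f) (wops_functional_eq uP (w := \0)) // => n j /=.
have main m N : (0 < m)%N ->
    (forall j, L (P n j 0) = \sum_(m <= i < N) \sum_a Lam n i a j *: P i a 0) ->
    u (L (P n j 0)) = 0.
  move=> m0 ->; rewrite raddf_sum big_nat big1 // => i /andP[mi _].
  rewrite raddf_sum big1 // => a _ /=.
  by rewrite linearZ /= (wops_mean0 uP) ?mulr0 // (leq_trans m0).
have [ns|ns] := leqP n s.
  by apply: (main 1%N (n + s).+1) => //; apply/relation_entry/lo.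
apply: (main (n - s)%N (n + s).+1); first by rewrite subn_gt0.
exact/relation_entry/hi.
Qed.

Lemma diff_rel_lin_ortho : diff_rel P Phi Psi s ->
  forall n j k, (s.+1 < n)%N -> u ('X_k * L (P n j 0)) = 0.
Proof.
move=> [Lam [hi _]] n j k ns.
have /relation_entry -> := hi n (ltnW ns).
rewrite mulr_sumr raddf_sum big_nat big1 // => i /andP[ni _].
rewrite mulr_sumr raddf_sum big1 // => a _ /=.
rewrite -scalerAr linearZ /= (wops_orthogonal uP) ?mulr0 //.
by rewrite msizeX mdeg1; lia.
Qed.

(** The column Psi' need not be Psi. *)
Lemma diff_rel_pearson : diff_rel P Phi Psi s ->
  exists Psi' : 'cV[{mpoly R[d]}]_d, pearson u Phi Psi'.
Proof.
move=> rel; case: adm => symPhi _ dPsi _.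
suff /fin_all_exists[a ha] : forall k, exists a,
    forall f, - u (\sum_j Phi k j * f^`M(j)) = u (a * f).
  exists (\col_k a k); apply/pearsonP => f i.
  by rewrite mxE -ha opprK.
move=> k.
have lin : scalar (fun f => - u (\sum_j Phi k j * f^`M(j))).
  move=> b g h /=.
  rewrite (_ : \sum_j _ = b *: (\sum_j Phi k j * g^`M(j))
                           + \sum_j Phi k j * h^`M(j)).
    by rewrite linearP /= opprD mulrN.
  rewrite scaler_sumr -big_split; apply: eq_bigr => j _ /=.
  by rewrite linearP mulrDr scalerAr.
pose v : {scalar {mpoly R[d]}} :=
  HB.pack (fun f => - u (\sum_j Phi k j * f^`M(j)))
  (GRing.isLinear.Build R {mpoly R[d]} R _ _ lin).
(* The bound N ensures both n > s + 1, for <u, x_k L P_n> = 0, and n > q, for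
   <u, psi_k P_n> = 0. *)
apply: (wops_functional_repr uP (v := v) (N := (s + q).+2)) => n i nN /=.
have := diff_rel_mean0 rel ('X_k * P n i 0).
rewrite LopM_X // !raddfD /= (diff_rel_lin_ortho rel); last by lia.
rewrite (wops_orthogonal (f := Psi k 0) uP).
  rewrite addr0 add0r -mulr2n => /eqP; rewrite mulrn_eq0 => /eqP ->.
  by rewrite oppr0.
by apply: leq_trans (has_deg_msize dPsi k 0) _; lia.
Qed.

(** A column Psi' that satisfies the Pearson equation cannot be constant when
    <u, Phi> is invertible. *)
Lemma pearson_nonconstant (Psi' : 'cV[{mpoly R[d]}]_d) :
  (0 < d)%N -> \det (map_mx u Phi) != 0 -> pearson u Phi Psi' ->
  exists2 q', (1 <= q')%N & has_deg Psi' q'.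
Proof.
move=> d_gt0 det_neq0 /pearsonP pea.
pose M := (\max_(i < d) \max_(j < 1) msize (Psi' i j))%N.
have [M1|M2] := leqP M 1; last by exists M.-1; rewrite /has_deg -/M; lia.
have Psi'C i : Psi' i 0 = ((Psi' i 0)@_0)%:MP.
  by apply: msize1_polyC; apply: leq_trans M1; apply: msize_entry_leq.
(* For constant Psi', the Pearson equation at f = 1 reads Psi' <u, 1> = 0. *)
have Psi'0 i : Psi' i 0 = 0.
  have := pea 1 i; rewrite big1 => [|j _]; last first.
    by rewrite -mpolyC1 mderivC mulr0.
  rewrite Psi'C mul_mpolyC linearZ raddf0 /= => /esym/eqP.
  rewrite oppr_eq0 mulf_eq0 (negPf (wops_mass_neq0 uP)) orbF => /eqP->.
  by rewrite mpolyC0.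
case/negP: det_neq0; rewrite (_ : map_mx u Phi = 0).
  by rewrite -(scale0r 0) detZ expr0n gtn_eqF // mul0r.
apply/matrixP=> i k; rewrite !mxE; have := pea 'X_k i.
rewrite Psi'0 mul0r raddf0 oppr0 (bigD1 k) //= mderivXU eqxx mulr1.
rewrite big1 ?addr0 // => j /negbTE jk.
by rewrite mderivXU jk mulr0.
Qed.

End Relation.

Theorem theorem3p4 (R : realType) (d : nat) (d_gt0 : (0 < d)%N)
    (u : {scalar {mpoly R[d]}}) (uqd : quasi_definite u)
    (P : poly_seq R d) (uP : wops u P) :
  (forall (Phi : 'M[{mpoly R[d]}]_d) (Psi : 'cV[{mpoly R[d]}]_d) (p q : nat),
     semiclassical_pair u Phi Psi p q ->
     diff_rel P Phi Psi (shift p q)) /\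
  ((exists (Phi : 'M[{mpoly R[d]}]_d) (Psi : 'cV[{mpoly R[d]}]_d) (p q : nat),
      [/\ admissible Phi Psi p q,
          \det (map_mx u Phi) != 0
        & diff_rel P Phi Psi (shift p q)]) ->
   semiclassical u).
Proof.
split=> [Phi Psi p q [adm _ pea]|[Phi [Psi [p [q [adm det_neq0 rel]]]]]].
  exact: (pearson_diff_rel uP adm pea).
split=> //.
have [Psi' pea] := diff_rel_pearson uP adm rel.
have [q' q'1 dPsi'] := pearson_nonconstant uP d_gt0 det_neq0 pea.
exists Phi, Psi', p, q'; split=> //.
by case: adm => symPhi dPhi _ _; split.
Qed.
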